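(* Consider the complete feedback game on a deck of $n$ cards shuffled once by an asymmetric single-shelf shuffle with parameter $p$, and let $\mathrm{FC}_n$ denote the first (top) card of the shuffled deck. The following strategies are optimal, i.e. they maximize the expected number of correct guesses over all guessing strategies. (a) If $p\in[\frac12,1]$: guess the card labelled $1$ first, and then always guess the label immediately following that of the previously shown card, until card $n-1$ or $n$ is shown; after that, guess the remaining cards in descending order (these guesses are guaranteed to be correct). (b) If $p\in(0,\frac12)$, let $\nu=\lfloor \ln(p)/\ln(1-p)\rfloor+1$. Guess as the first card the label \[ \mathrm{maxP}_n=\arg\max_{j}\mathbb{P}(\mathrm{FC}_n=j)=\begin{cases} n, & 2\le n\le\nu,\\ 1, & n>\nu,\end{cases} \] breaking ties by choosing $n$. After a card, say labelled $j$, is shown, proceed similarly with the reduced set of labels $\{j+1,\dots,n\}$: guess the label from $\{j+1,n\}$ corresponding to the maximum of $\{p,(1-p)^{n-j-1}\}$ (label $j+1$ corresponds to $p$, label $n$ to $(1-p)^{n-j-1}$, ties broken by choosing $n$), until card $n$ or $n-1$ is shown; after that, guess all the remaining cards in decreasing order.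
   Context: Asymmetric single-shelf shuffle with parameter $p$: start with an ordered deck of $n$ cards labelled $1,\dots,n$ (card $1$ on top). Cards are drawn one at a time from the bottom of the deck (card $n$ first, card $1$ last) and placed in a pile; independently, each drawn card is placed at the top of the pile with probability $p$ and at the bottom with probability $1-p$. Equivalently, let $\varepsilon_1,\dots,\varepsilon_{n-1}$ be independent Bernoulli$(p)$ ($\varepsilon_j=1$ iff card $j$ is placed at the top); the shuffled deck read from the top consists of the cards $j\le n-1$ with $\varepsilon_j=1$ in increasing order, then card $n$, then the cards with $\varepsilon_j=0$ in decreasing order. Complete feedback game: the player guesses the cards of the shuffled deck sequentially from the top; after each guess the player is shown the card, and the card is removed. A guessing strategy chooses each guess based on the cards shown so far; an optimal strategy is one maximizing the expected number of correct guesses. *)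

(* Defs.v *)
From mathcomp Require Import all_boot all_order all_algebra.
From mathcomp Require Import reals exp bernoulli_distribution.

Set Implicit Arguments.
Unset Strict Implicit.
Unset Printing Implicit Defensive.

Import Order.TTheory GRing.Theory Num.Theory.
Local Open Scope ring_scope.

(* Cards carry the labels 1, ..., n; [i : 'I_n] stands for the card labelled
   [i.+1], and the head of a pile is its top card.  The cards are drawn in the
   order n, n-1, ..., 1, and [eps i] tells whether card [i.+1] goes to the top
   of the pile.  The coin of card n, which starts the pile, has no effect. *)
Definition place n (eps : {ffun 'I_n -> bool}) (pile : seq nat) (i : 'I_n) :=
  if eps i then i.+1 :: pile else rcons pile i.+1.

Definition deck n (eps : {ffun 'I_n -> bool}) : seq nat :=
  foldl (place eps) [::] (rev (enum 'I_n)).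

Lemma foldl_place n (eps : {ffun 'I_n -> bool}) (pile : seq nat)
    (s : seq 'I_n) :
  foldl (place eps) pile (rev s) =
    [seq i.+1 | i : 'I_n <- s & eps i] ++
    pile ++ rev [seq i.+1 | i : 'I_n <- s & ~~ eps i].
Proof.
elim: s => [|x s IHs] /=; first by rewrite cats0.
rewrite rev_cons foldl_rcons IHs /place; case: (eps x) => //=.
by rewrite rev_cons !rcons_cat.
Qed.

(* From the top: increasing run of the top-placed cards, the largest card,
   decreasing run of the bottom-placed cards. *)
Lemma deckE n (eps : {ffun 'I_n.+1 -> bool}) :
  deck eps =
    [seq i.+1 | i : 'I_n.+1 <- enum 'I_n.+1 & (i < n)%N && eps i] ++
    n.+1 ::
    rev [seq i.+1 | i : 'I_n.+1 <- enum 'I_n.+1 & (i < n)%N && ~~ eps i].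
Proof.
have topF (P : pred 'I_n.+1) :
    [seq i : 'I_n.+1 <- enum 'I_n.+1 | (i < n)%N && P i] =
    [seq i <- [seq widen_ord (leqnSn n) j | j <- enum 'I_n] | P i].
  rewrite enum_ordSr filter_rcons /= ltnn /=; apply: eq_in_filter => i.
  by case/mapP => j _ ->; rewrite /= ltn_ord.
rewrite /deck !topF enum_ordSr rev_rcons /= foldl_place /place.
by case: (eps ord_max).
Qed.

Definition coin_prob (R : realType) (p : R) (n : nat)
    (eps : {ffun 'I_n -> bool}) : R :=
  \prod_(i < n) bernoulli_pmf p (eps i).

Definition first_card_prob (R : realType) (p : R) (n j : nat) : R :=
  \sum_(eps : {ffun 'I_n -> bool} | head 0%N (deck eps) == j) coin_prob p eps.

(* A strategy maps the cards shown so far, listed from the first one shown, to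
   the next guess; a guess that is not a label is simply never correct. *)
Definition strategy := seq nat -> nat.

Definition correct_guesses (S : strategy) (d : seq nat) : nat :=
  (\sum_(i < size d) (S (take i d) == nth 0 d i))%N.

Definition expected_correct (R : realType) (p : R) (n : nat)
    (S : strategy) : R :=
  \sum_(eps : {ffun 'I_n -> bool})
     coin_prob p eps * (correct_guesses S (deck eps))%:R.

Definition optimal (R : realType) (p : R) (n : nat) (S : strategy) : Prop :=
  forall S' : strategy, expected_correct p n S' <= expected_correct p n S.

Definition largest_remaining (n : nat) (h : seq nat) : nat :=
  (\max_(i < n | i.+1 \notin h) i.+1)%N.

Definition end_shown (n : nat) (h : seq nat) : bool :=
  (n \in h) || (n.-1 \in h).

Definition follow_strategy (n : nat) : strategy := fun h =>
  if end_shown n h then largest_remaining n h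
  else if h is [::] then 1%N else (last 0%N h).+1.

Definition most_likely_first (R : realType) (p : R) (n j : nat) : bool :=
  [forall k : 'I_n, first_card_prob p n k.+1 <= first_card_prob p n j].

(* Ties go to the largest maximizer, hence to n whenever n is one. *)
Definition maxP (R : realType) (p : R) (n : nat) : nat :=
  (\max_(i < n | most_likely_first p n i.+1) i.+1)%N.

Definition nu (R : realType) (p : R) : int := Num.floor (ln p / ln (1 - p)) + 1.

Definition greedy_strategy (R : realType) (p : R) (n : nat)
    : strategy := fun h =>
  if end_shown n h then largest_remaining n h
  else if h is [::] then maxP p n
  else let j := last 0%N h in
       if p <= (1 - p) ^+ (n - j - 1) then n else j.+1.

(* Main.v *)
Require Import Defs.
From mathcomp Require Import all_boot all_order all_algebra.
From mathcomp Require Import reals exp bernoulli_distribution.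
From mathcomp Require Import zify lra.

Set Implicit Arguments.
Unset Strict Implicit.
Unset Printing Implicit Defensive.

Import Order.TTheory GRing.Theory Num.Theory.
Local Open Scope ring_scope.

(** The guesses have no influence on what is shown, so a strategy is optimal as
    soon as, after every history [h] that can occur, its guess maximizes over
    [c] the probability that the deck starts with [rcons h c]
    ([optimal_pointwise]): the expected number of correct guesses is the sum of
    these probabilities for the guesses made.  It remains to know them.

    The deck is an increasing run which ends with the largest card [N],
    followed by a decreasing run ([deck_rising]).

    While [N] has not been shown, the history [h] is increasing.  That the deck
    starts with an increasing sequence [u] says exactly, for each card up to
    [last 0 u] other than [N], which way its coin fell, heads if and only if the
    card is in [u]; this event is a cylinder and its probability is a product
    ([prefix_prob_rising]).  Hence, with [j] the last card shown, the next card
    is [c] with conditional probability [p * (1 - p) ^+ (c - j - 1)] for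
    [j < c < N], and [(1 - p) ^+ (N - 1 - j)] for [c = N]
    ([prefix_prob_rcons]).  The first expression is largest at [c = j + 1],
    where it is [p], so only [p] and [(1 - p) ^+ (N - 1 - j)] compete
    ([greedy_label_best]).  When [p >= 1 / 2] and [j < N - 1], the second one is
    at most [1 - p <= p], so that [j + 1] is always a best guess
    ([follow_label_best]).

    Once [N] or [N - 1] has been shown, what follows is [N], unless already
    shown, and then a decreasing run; so the next card is always the largest
    one not shown ([endgame]), and guessing it is correct with certainty.

    With the empty history ([j = 0]) the same conditional probabilities give
    the law of the first card, hence [maxP] ([maxPE]); taking logarithms in
    [p <= (1 - p) ^+ (N - 1)] turns the criterion into [N <= nu p] ([nu_ge]). *)

(** * Increasing sequences of natural numbers *)

Lemma path_ltn_le_last x y u :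
  path ltn x u -> y \in u -> (y <= last x u)%N.
Proof.
elim/last_ind: u => // u z IHu; rewrite rcons_path last_rcons mem_rcons inE.
case/andP => pu ltz /predU1P[-> //|/(IHu pu) ley].
exact: leq_trans ley (ltnW ltz).
Qed.

Lemma prefix_filter_leq l x s :
  path ltn x s -> prefix [seq k <- s | (k <= l)%N] s.
Proof.
elim: s x => [|y s IHs] x //= /andP[_ ps].
case: leqP => [_|lty]; first by rewrite eqxx (IHs y).
rewrite (_ : [seq _ <- _ | _] = [::]) //; apply/eqP.
rewrite -[_ == _]negbK -has_filter -all_predC.
apply/allP => z zs /=; rewrite -ltnNge; apply: ltn_trans lty _.
by have /allP/(_ z zs) := order_path_min ltn_trans ps.
Qed.

(** * The two runs of the shuffled deck *)

Lemma perm_deck n (eps : {ffun 'I_n -> bool}) : perm_eq (deck eps) (iota 1 n).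
Proof.
rewrite /deck foldl_place cat0s -map_rev -map_cat.
rewrite (iotaDl 1 0) -val_enum_ord -map_comp; apply: perm_map.
rewrite perm_sym -(perm_filterC eps) perm_sym.
by rewrite perm_cat2l perm_rev.
Qed.

Lemma size_deck n (eps : {ffun 'I_n -> bool}) : size (deck eps) = n.
Proof. by rewrite (perm_size (perm_deck eps)) size_iota. Qed.

Lemma mem_deck n (eps : {ffun 'I_n -> bool}) k :
  (k \in deck eps) = (0 < k <= n)%N.
Proof. by rewrite (perm_mem (perm_deck eps)) mem_iota add1n ltnS. Qed.

Lemma uniq_deck n (eps : {ffun 'I_n -> bool}) : uniq (deck eps).
Proof. by rewrite (perm_uniq (perm_deck eps)) iota_uniq. Qed.

Definition labels n (P : pred 'I_n) : seq nat :=
  [seq i.+1 | i : 'I_n <- enum 'I_n & P i].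

(** The bound 0 makes [path] say at once that the sequence increases and that
    its entries are positive, as labels must be. *)
Lemma path_labels n (P : pred 'I_n) : path ltn 0 (labels P).
Proof.
have: sorted ltn (map val (enum 'I_n)) by rewrite val_enum_ord iota_ltn_sorted.
rewrite sorted_map => se.
rewrite path_min_sorted; last by apply/allP => k /mapP[i _ ->].
rewrite sorted_map.
apply: (sorted_filter (leT := relpre (fun i : 'I_n => i.+1) ltn)) => //.
by move=> j i k /=; apply: ltn_trans.
Qed.

Lemma mem_labels n (P : pred 'I_n) (i : 'I_n) : (i.+1 \in labels P) = P i.
Proof.
apply/mapP/idP => [[j + [/val_inj ->]]|Pi].
  by rewrite mem_filter => /andP[].
by exists i; rewrite // mem_filter Pi mem_enum.
Qed.

Lemma labelsP n (P : pred 'I_n) k :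
  k \in labels P -> exists2 i : 'I_n, P i & k = i.+1.
Proof.
by case/mapP => i; rewrite mem_filter => /andP[Pi _] ->; exists i.
Qed.

Lemma mem_labels_le n (P : pred 'I_n) k : k \in labels P -> (k <= n)%N.
Proof. by case/labelsP => i _ ->. Qed.

(** The largest card, whose coin has no effect, is counted in the increasing
    run: the end of that run is then recognized by the card shown, and not by
    the coin. *)
Definition rising n (eps : {ffun 'I_n.+1 -> bool}) : pred 'I_n.+1 :=
  fun i => eps i || (i == ord_max).

Lemma ltn_max n (i : 'I_n.+1) : (i < n)%N = (i != ord_max).
Proof. by rewrite ltn_neqAle -ltnS ltn_ord andbT. Qed.

Lemma deck_rising n (eps : {ffun 'I_n.+1 -> bool}) :
  deck eps = labels (rising eps) ++ rev (labels (predC (rising eps))).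
Proof.
rewrite deckE -cat_rcons /labels; congr (_ ++ rev _); last first.
  by congr map; apply: eq_filter => i /=; rewrite ltn_max negb_or andbC.
rewrite enum_ordSr !filter_rcons /= ltnn /rising eqxx orbT map_rcons.
congr rcons; congr map; apply: eq_in_filter => i /mapP[j _ ->].
by rewrite /= ltn_ord -[_ == ord_max]negbK -ltn_max /= ltn_ord orbF.
Qed.

Lemma mem_labels_rising_top n (eps : {ffun 'I_n.+1 -> bool}) :
  n.+1 \in labels (rising eps).
Proof. by rewrite (mem_labels (rising eps) ord_max) /rising eqxx orbT. Qed.

(** An increasing prefix cannot go past the largest card, which ends the
    increasing run. *)
Lemma prefix_deck_rising n (eps : {ffun 'I_n.+1 -> bool}) u :
  path ltn 0 u -> (last 0 u <= n.+1)%N ->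
  prefix u (deck eps) = prefix u (labels (rising eps)).
Proof.
move=> pu lu; rewrite deck_rising; set Q := labels _; set B := rev _.
apply/idP/idP; last by apply: prefix_catl.
rewrite !prefixE take_cat; case: ltnP => // leQu /eqP uE.
suff -> : u = Q by rewrite take_size.
move: uE; case: (take _ _) => [|b v]; first by rewrite cats0 => ->.
(* A card [b] after [Q] would exceed the largest card, a member of [Q]. *)
move=> uE; move: (pu) lu; rewrite -uE cat_path last_cat /= => /and3P[_ ltb pv].
have topQ : (n.+1 <= last 0 Q)%N.
  exact: path_ltn_le_last (path_labels _) (mem_labels_rising_top eps).
have bv : (b <= last 0 u)%N.
  by apply: path_ltn_le_last pu _; rewrite -uE mem_cat mem_head orbT.
rewrite -uE last_cat /= in bv => lu.
have := leq_trans (leq_trans (leq_ltn_trans topQ ltb) bv) lu.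
by rewrite ltnn.
Qed.

(** A prefix of an increasing list is cut out by a threshold on the values, so
    it constrains membership below that threshold and nothing above it. *)
Lemma prefix_labels n (P : pred 'I_n) u :
  path ltn 0 u -> (last 0 u <= n)%N ->
  prefix u (labels P) =
    [forall i : 'I_n, (i < last 0 u)%N ==> (P i == (i.+1 \in u))].
Proof.
move=> pu lu; apply/idP/forallP => [/prefixP[v vE] i|uP].
  apply/implyP => ltil; have := path_labels P; rewrite -(mem_labels P) vE.
  rewrite cat_path => /andP[_] /(order_path_min ltn_trans)/allP pv.
  rewrite mem_cat orbC; case: (boolP (_ \in v)) => [/pv /=|_]; last by [].
  by rewrite ltnNge ltil.
have -> : u = [seq k <- labels P | (k <= last 0 u)%N]; last first.
  exact: prefix_filter_leq (path_labels P).
apply: (irr_sorted_eq ltn_trans ltnn) => [||k].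
- exact: path_sorted pu.
- by apply: (sorted_filter ltn_trans); apply: path_sorted (path_labels P).
rewrite mem_filter; apply/idP/andP => [ku|[lek /labelsP[i Pi kE]]].
  have lek := path_ltn_le_last pu ku; split=> //.
  have /allP/(_ k ku) := order_path_min ltn_trans pu.
  case: k => // k in ku lek * => _.
  have ltk := leq_trans lek lu.
  rewrite (mem_labels P (Ordinal ltk)).
  by have /implyP/(_ lek)/eqP -> := uP (Ordinal ltk).
by move: lek; rewrite kE => lek; have /implyP/(_ lek)/eqP <- := uP i.
Qed.

(** As long as the largest card is not in the history, the history and the
    next card lie inside the increasing run. *)
Lemma path_top_unshown n (eps : {ffun 'I_n.+1 -> bool}) h c :
  prefix (rcons h c) (deck eps) -> n.+1 \notin h ->
  path ltn 0 (rcons h c) /\ (c <= n.+1)%N.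
Proof.
rewrite deck_rising; set Q := labels _; set B := rev _ => hc nh.
have ltQ : (size h < size Q)%N.
  rewrite ltnNge; apply: contra nh => leQ.
  move: hc; rewrite -cats1 => /catl_prefix.
  rewrite prefixE take_cat ltnNge leQ => /eqP <-.
  by rewrite mem_cat mem_labels_rising_top.
move: hc; rewrite prefixE size_rcons takel_cat //.
rewrite -[_.+1](size_rcons h c) -prefixE.
case/prefixP => v vE; split.
  by have := path_labels (rising eps); rewrite -/Q vE cat_path => /andP[].
apply: (@mem_labels_le _ (rising eps)).
by rewrite -/Q vE mem_cat mem_rcons mem_head.
Qed.

(** * The deterministic end of the game *)

(** If the largest card is shown, the game is in the decreasing run.  If only
    the second largest is, the increasing run has just one card left, the
    largest. *)
Lemma unshown_le_next n (eps : {ffun 'I_n.+1 -> bool}) i k :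
  (i < n.+1)%N -> end_shown n.+1 (take i (deck eps)) ->
  k \in deck eps -> k \notin take i (deck eps) ->
  (k <= nth 0%N (deck eps) i)%N.
Proof.
move=> lti shown kd; set h := take i _ => kh; set c := nth _ _ _.
have [nh|nh] := boolP (n.+1 \in h); last first.
  have [] := @path_top_unshown n eps h c _ nh.
    by rewrite -take_nth ?size_deck // prefix_take.
  rewrite rcons_path => /andP[ph hc] cn.
  suff -> : c = n.+1 by move: kd; rewrite mem_deck => /andP[].
  apply/eqP; rewrite eqn_leq cn; move: shown; rewrite /end_shown (negPf nh) /=.
  by move=> /(path_ltn_le_last ph)/leq_ltn_trans; apply.
set Q := labels (rising eps); set B := labels (predC (rising eps)).
have deckQB : deck eps = Q ++ rev B by exact: deck_rising.
have leQ : (size Q <= i)%N.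
  rewrite leqNgt; apply/negP => ltQ.
  move: nh; rewrite /h deckQB takel_cat; last exact: ltnW.
  move=> nh; have := path_labels (rising eps).
  rewrite -/Q -(cat_take_drop i Q) cat_path (drop_nth 0%N ltQ) /=.
  case/and3P=> p1 p2 _; have nl := path_ltn_le_last p1 nh.
  have := mem_labels_le (mem_nth 0%N ltQ : _ \in labels _).
  by rewrite leqNgt (leq_ltn_trans nl p2).
have kB : k \in drop i (deck eps).
  by move: kd; rewrite -{1}(cat_take_drop i (deck eps)) mem_cat (negPf kh).
move: kB; rewrite /c deckQB drop_cat nth_cat !ltnNge leQ /=.
have sB : sorted gtn (rev B).
  by rewrite rev_sorted; apply: path_sorted (path_labels _).
have := drop_sorted (i - size Q) sB.
rewrite -[X in nth _ _ X]addn0 -nth_drop nth0.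
case: (drop _ _) => //= x s sorted_s; rewrite inE => /predU1P[-> //|ks].
have gtn_trans : transitive gtn by move=> y x' z /= yx /ltn_trans; apply.
by move: sorted_s => /(order_path_min gtn_trans)/allP/(_ k ks)/ltnW.
Qed.

Lemma endgame n (eps : {ffun 'I_n.+1 -> bool}) i :
  (i < n.+1)%N -> end_shown n.+1 (take i (deck eps)) ->
  largest_remaining n.+1 (take i (deck eps)) = nth 0%N (deck eps) i.
Proof.
move=> lti shown; set h := take i _; set c := nth _ _ _.
have c_deck : c \in deck eps by rewrite mem_nth ?size_deck.
have c_new : c \notin h.
  have := take_uniq i.+1 (uniq_deck eps).
  by rewrite (take_nth 0%N) ?size_deck // rcons_uniq => /andP[].
apply/eqP; rewrite eqn_leq; apply/andP; split.
  apply/bigmax_leqP => k kh.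
  by apply: unshown_le_next; rewrite ?mem_deck /= ?ltn_ord.
move: c_deck c_new; rewrite mem_deck; case: (c) => // c' cn c_new.
exact: (@leq_bigmax_cond _ (fun k : 'I_n.+1 => k.+1 \notin h) (fun k => k.+1)
          (Ordinal cn)).
Qed.

(** * Probability of an increasing prefix *)

(** Independence: the coins outside [P] sum to one. *)
Lemma sum_coin_cylinder (R : realType) (p : R) n (P b : pred 'I_n) :
  \sum_(eps : {ffun 'I_n -> bool} | [forall i, P i ==> (eps i == b i)])
     coin_prob p eps = \prod_(i < n | P i) bernoulli_pmf p (b i).
Proof.
rewrite [RHS]big_mkcond /=.
transitivity (\prod_(i < n) \sum_(x | P i ==> (x == b i)) bernoulli_pmf p x).
  rewrite bigA_distr_big_dep; apply: eq_bigl => eps.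
  by apply/forallP/familyP => h i; have := h i.
apply: eq_bigr => i _; case: (P i) => /=; first by rewrite big_pred1_eq.
by rewrite big_bool /= addrCA subrr addr0.
Qed.

Lemma coin_prob_ge0 (R : realType) (p : R) n (eps : {ffun 'I_n -> bool}) :
  0 <= p <= 1 -> 0 <= coin_prob p eps.
Proof. by move=> p01; apply: prodr_ge0 => i _; apply: bernoulli_pmf_ge0. Qed.

Definition prefix_prob (R : realType) (p : R) n (u : seq nat) : R :=
  \sum_(eps : {ffun 'I_n -> bool} | prefix u (deck eps)) coin_prob p eps.

Lemma prefix_prob_ge0 (R : realType) (p : R) n u :
  0 <= p <= 1 -> 0 <= prefix_prob p n u.
Proof. by move=> p01; apply: sumr_ge0 => eps _; apply: coin_prob_ge0. Qed.

Lemma prefix_prob_rcons_le (R : realType) (p : R) n h c :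
  0 <= p <= 1 -> prefix_prob p n (rcons h c) <= prefix_prob p n h.
Proof.
move=> p01; rewrite /prefix_prob [leLHS]big_mkcond [leRHS]big_mkcond.
apply: ler_sum => eps _; have p_ge0 := coin_prob_ge0 eps p01.
case: ifP => [|_]; last by case: ifP.
by rewrite -cats1 => /catl_prefix ->.
Qed.

(** The minimum with [n] leaves out the coin of the largest card [n.+1], which
    may be the last card of [u]. *)
Lemma prefix_prob_rising (R : realType) (p : R) n u :
  path ltn 0 u -> (last 0 u <= n.+1)%N ->
  prefix_prob p n.+1 u =
    \prod_(0 <= k < minn n (last 0 u)%N) bernoulli_pmf p (k.+1 \in u).
Proof.
move=> pu lu; rewrite big_mkord.
rewrite (big_ord_widen n.+1 (fun k => bernoulli_pmf p (k.+1 \in u))); last first.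
  exact: leq_trans (geq_minl _ _) (leqnSn n).
rewrite -(sum_coin_cylinder p _ (fun i : 'I_n.+1 => i.+1 \in u)).
apply: eq_bigl => eps; rewrite prefix_deck_rising // prefix_labels //.
apply: eq_forallb => i; rewrite leq_min /rising.
have [->|neq_in] := eqVneq i ord_max; last first.
  by rewrite orbF ltn_max neq_in.
rewrite /= ltnn orbT; apply/implyP => ltn_l.
have lE : last 0%N u = n.+1 by apply/eqP; rewrite eqn_leq lu.
by case: (u) lE => // x v /= <-; rewrite mem_last.
Qed.

(** * Conditional law of the next card *)

(** The conditional probability that [c] comes next in a deck of [n.+1] cards,
    given an increasing history which ends with [j], or an empty one if
    [j = 0]. *)
Definition next_prob (R : realType) (p : R) n j c : R :=
  if c == n.+1 then (1 - p) ^+ (n - j) else p * (1 - p) ^+ (c - j.+1).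

(** Appending [c] adds the constraints on the coins of the cards from
    [(last 0 h).+1] to [c]: all tails, except that of [c] itself, which falls
    on heads or, for the largest card, is irrelevant. *)
Lemma prefix_prob_rcons (R : realType) (p : R) n h c :
  path ltn 0 (rcons h c) -> (c <= n.+1)%N ->
  prefix_prob p n.+1 (rcons h c) =
    prefix_prob p n.+1 h * next_prob p n (last 0%N h) c.
Proof.
move=> ph cn; have /andP[ph' hc] : path ltn 0 h && (last 0 h < c)%N.
  by rewrite -[_ && _](rcons_path ltn).
have lh : (last 0 h <= n)%N by rewrite -ltnS (leq_trans hc).
rewrite !prefix_prob_rising ?last_rcons ?(leqW lh) // (minn_idPr lh).
have lc : (last 0 h <= minn n c)%N by rewrite leq_min lh ltnW.
rewrite (big_cat_nat (leq0n _) lc) /=; congr (_ * _).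
  apply: eq_big_nat => k /andP[_ kh].
  by rewrite mem_rcons inE (ltn_eqF (leq_ltn_trans kh hc)).
have memF k : (last 0 h <= k)%N -> (k.+1 \in rcons h c) = (k.+1 == c).
  move=> hk; rewrite mem_rcons inE.
  case: (boolP (_ \in h)); last by rewrite orbF.
  by move/(path_ltn_le_last ph'); rewrite leqNgt ltnS hk.
rewrite /next_prob; case: eqP => [cE|/eqP neq_c].
  rewrite {1}cE (minn_idPl (leqnSn n)) -prodr_const_nat; apply: eq_big_nat => k.
  by case/andP=> /memF-> kn; rewrite cE eqSS (ltn_eqF kn).
have {}cn : (c <= n)%N by rewrite -ltnS ltn_neqAle neq_c.
rewrite (minn_idPr cn); case: c => // c in hc memF {ph cn neq_c lc} *.
rewrite big_nat_recr //= memF // eqxx mulrC subSS -prodr_const_nat.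
congr (_ * _); apply: eq_big_nat => k /andP[/memF -> kc].
by rewrite eqSS (ltn_eqF kc).
Qed.

Lemma next_prob_top (R : realType) (p : R) n j :
  next_prob p n j n.+1 = (1 - p) ^+ (n - j).
Proof. by rewrite /next_prob eqxx. Qed.

Lemma next_prob_succ (R : realType) (p : R) n j :
  (j < n)%N -> next_prob p n j j.+1 = p.
Proof. by move=> jn; rewrite /next_prob eqSS ltn_eqF // subnn mulr1. Qed.

Lemma next_prob_le (R : realType) (p : R) n j c :
  0 <= p <= 1 ->
  next_prob p n j c <= p \/ next_prob p n j c = next_prob p n j n.+1.
Proof.
case/andP=> p0 p1; rewrite /next_prob eqxx; case: ifP => _; [by right | left].
by rewrite ler_piMr // exprn_ile1 ?subr_ge0 // gerBl.
Qed.

Definition greedy_label (R : realType) (p : R) n j :=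
  if p <= (1 - p) ^+ (n - j) then n.+1 else j.+1.

Lemma greedy_label_best (R : realType) (p : R) n j (g := greedy_label p n j) :
  0 <= p <= 1 -> (j <= n)%N -> (j < g <= n.+1)%N /\
  forall c, next_prob p n j c <= next_prob p n j g.
Proof.
move=> p01 jn; rewrite /g /greedy_label; case: leP => hp.
  split=> [|c]; first by rewrite ltnS jn leqnn.
  case: (next_prob_le n j c p01) => [/le_trans|->//].
  by apply; rewrite next_prob_top.
have {}jn : (j < n)%N.
  rewrite ltn_neqAle jn andbT; apply: contraTneq hp => ->.
  by rewrite subnn expr0 -leNgt; case/andP: p01.
split=> [|c]; first by rewrite ltnS leqnn ltnW.
rewrite next_prob_succ //; case: (next_prob_le n j c p01) => [//|->].
by rewrite next_prob_top ltW.
Qed.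

(** For [j = n] the card [j.+1] is the largest one and the only candidate. *)
Lemma follow_label_best (R : realType) (p : R) n j :
  2^-1 <= p <= 1 -> (j <= n)%N -> (j < j.+1 <= n.+1)%N /\
  forall c, (j < c <= n.+1)%N -> next_prob p n j c <= next_prob p n j j.+1.
Proof.
move=> /andP[p2 p1] jn; have p01 : 0 <= p <= 1 by lra.
split=> [|c jc]; first by lia.
have [ltjn|lenj] := ltnP j n; last first.
  by have -> : c = j.+1 by lia.
rewrite next_prob_succ //; case: (next_prob_le n j c p01) => // ->.
rewrite next_prob_top; have /subnK <- : (0 < n - j)%N by rewrite subn_gt0.
rewrite addn1 exprSr; have q01 : 0 <= (1 - p) ^+ (n - j - 1) <= 1.
  by rewrite exprn_ge0 ?exprn_ile1; lra.
nra.
Qed.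

(** * Optimality of stepwise best guesses *)

Lemma ler_sum_fibres (R : realType) (I : finType) (T : eqType) (f : I -> T)
    (F G : I -> R) :
  (forall i0, \sum_(i | f i == f i0) F i <= \sum_(i | f i == f i0) G i) ->
  \sum_i F i <= \sum_i G i.
Proof.
(* [T] need not be finite, so the sums are split along the fibres as sets. *)
move=> leFG; pose fibre i := [set k | f k == f i].
have fibreE i i0 : (fibre i == fibre i0) = (f i == f i0).
  apply/eqP/eqP => [/setP/(_ i)|fE].
    by rewrite !inE eqxx => /esym/eqP.
  by rewrite /fibre fE.
rewrite !(partition_big fibre predT) //=; apply: ler_sum => C _.
have [i0 /eqP <-|noC] := pickP (fun i => fibre i == C).
  by rewrite !(eq_bigl _ _ (fibreE^~ i0)).
by rewrite !big_pred0.
Qed.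

(** The [i]-th guess is decided by the history [take i (deck eps)]; summing
    over the decks with a given history [h], the probability of a correct guess
    [c] is that of the prefix [rcons h c]. *)
Lemma optimal_pointwise (R : realType) (p : R) n (S : strategy) :
  (forall (eps : {ffun 'I_n -> bool}) i c, (i < n)%N ->
     prefix_prob p n (rcons (take i (deck eps)) c) <=
     prefix_prob p n (rcons (take i (deck eps)) (S (take i (deck eps))))) ->
  optimal p n S.
Proof.
move=> best S'.
have expectedE (U : strategy) : expected_correct p n U =
    \sum_(i < n) \sum_(eps : {ffun 'I_n -> bool})
      coin_prob p eps * (U (take i (deck eps)) == nth 0%N (deck eps) i)%:R.
  rewrite exchange_big; apply: eq_bigr => eps _.
  by rewrite /correct_guesses size_deck natr_sum mulr_sumr.
rewrite !expectedE; apply: ler_sum => i _.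
apply: (ler_sum_fibres (f := fun eps : {ffun 'I_n -> bool} => take i (deck eps))).
move=> eps0 /=; set h := take i (deck eps0).
have guessE (U : strategy) :
    \sum_(eps : {ffun 'I_n -> bool} | take i (deck eps) == h)
      coin_prob p eps * (U (take i (deck eps)) == nth 0%N (deck eps) i)%:R =
    prefix_prob p n (rcons h (U h)).
  rewrite (eq_bigr (fun eps : {ffun 'I_n -> bool} =>
    if U h == nth 0%N (deck eps) i then coin_prob p eps else 0)).
    rewrite -big_mkcondr; apply: eq_bigl => eps.
    rewrite prefixE size_rcons size_takel ?size_deck ?(ltnW (ltn_ord i)) //.
    rewrite (take_nth 0%N) ?size_deck // eqseq_rcons.
    by rewrite [in RHS](eq_sym (nth _ _ _)).
  by move=> eps /eqP ->; case: eqP; rewrite ?mulr1 ?mulr0.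
by rewrite !guessE; apply: best.
Qed.

(** Until [n.+1] has been shown the history is increasing, so that the
    probabilities to be compared share the factor [prefix_prob p n.+1 h]. *)
Lemma optimal_next_prob (R : realType) (p : R) n (S : strategy) :
  0 <= p <= 1 ->
  (forall h, end_shown n.+1 h -> S h = largest_remaining n.+1 h) ->
  (forall h, let j := last 0%N h in ~~ end_shown n.+1 h -> (j <= n)%N ->
     (j < S h <= n.+1)%N /\
     forall c, (j < c <= n.+1)%N ->
       next_prob p n j c <= next_prob p n j (S h)) ->
  optimal p n.+1 S.
Proof.
move=> p01 Send Smax; apply: optimal_pointwise => eps i c lti; set h := take _ _.
have szh : size h = i by rewrite size_takel ?size_deck // ltnW.
have [shown|hidden] := boolP (end_shown n.+1 h).
  apply: (le_trans (prefix_prob_rcons_le _ _ _ p01)).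
  rewrite le_eqVlt (Send h shown); apply/orP; left; apply/eqP.
  apply: eq_bigl => eps0; rewrite !prefixE size_rcons szh.
  rewrite (take_nth 0%N) ?size_deck // eqseq_rcons.
  case: eqP => //= E; rewrite -E -endgame ?eqxx //.
  by rewrite E.
move: (hidden); rewrite /end_shown negb_or => /andP[nh _].
have [] := @path_top_unshown n eps h (nth 0%N (deck eps) i) _ nh.
  by rewrite -take_nth ?size_deck // prefix_take.
rewrite rcons_path => /andP[ph hc] cn.
have lh : (last 0 h <= n)%N by rewrite -ltnS (leq_trans hc).
have [/andP[hS Sn] best] := Smax h hidden lh.
have pS : path ltn 0 (rcons h (S h)) by rewrite rcons_path ph.
rewrite [leRHS]prefix_prob_rcons //.
have [/andP[pc c_n]|no_c] := boolP (path ltn 0 (rcons h c) && (c <= n.+1)%N).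
  rewrite prefix_prob_rcons // ler_wpM2l ?prefix_prob_ge0 // best // c_n andbT.
  by move: pc; rewrite rcons_path => /andP[].
(* Any other guess contradicts the rising history: it is never correct. *)
rewrite [leLHS]big_pred0; last first.
  by move=> eps0; apply: contraNF no_c => /path_top_unshown/(_ nh)[-> ->].
by rewrite -prefix_prob_rcons // prefix_prob_ge0.
Qed.

(** * The most likely first card *)

Lemma first_card_probE (R : realType) (p : R) n c :
  (0 < c <= n.+1)%N -> first_card_prob p n.+1 c = next_prob p n 0 c.
Proof.
move=> /andP[c0 cn].
have -> : first_card_prob p n.+1 c = prefix_prob p n.+1 (rcons [::] c).
  apply: eq_bigl => eps; have := size_deck eps; case: (deck eps) => //= x s _.
  by rewrite prefix0s andbT eq_sym.
rewrite prefix_prob_rcons //=; last by rewrite c0.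
by rewrite prefix_prob_rising //= minn0 big_geq // mul1r.
Qed.

(** For [0 < p < 1] the maximizer is unique unless [n.+1] is one, and [n.+1]
    then wins the tie. *)
Lemma maxPE (R : realType) (p : R) n :
  0 < p < 1 -> maxP p n.+1 = greedy_label p n 0.
Proof.
move=> /andP[p0 p1]; have p01 : 0 <= p <= 1 by lra.
have [/andP[g0 gn] best] := greedy_label_best p01 (leq0n n).
apply/eqP; rewrite eqn_leq; apply/andP; split; last first.
  move: g0 gn best; case: greedy_label => // g' _ gn best.
  apply: (@leq_bigmax_cond _ _ (fun k : 'I_n.+1 => k.+1) (Ordinal gn)).
  by apply/forallP => k; rewrite !first_card_probE ?best /= ?ltn_ord.
apply/bigmax_leqP => k /forallP /(_ ord0); rewrite !first_card_probE ?ltn_ord //.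
rewrite /greedy_label; case: (leP p) => [_ _|]; first exact: ltn_ord.
rewrite subn0 => lt_p; have n0 : (0 < n)%N.
  by case: (n) lt_p => //; rewrite expr0; lra.
(* Here [p] beats [n.+1], and a maximizer is at least as likely as [1]. *)
rewrite next_prob_succ // /next_prob; case: eqP => _ le_p.
  by rewrite subn0 in le_p; lra.
case: k le_p => -[|k] //= _; rewrite subSS subn0 => le_p.
suff : p * (1 - p) ^+ k.+1 < p by lra.
by rewrite gtr_pMr // exprn_ilt1 //; lra.
Qed.

(** Dividing by [ln (1 - p) < 0] reverses the inequality between logarithms. *)
Lemma nu_ge (R : realType) (p : R) n :
  0 < p < 1 -> (n.+1%:Z <= nu p) = (p <= (1 - p) ^+ n).
Proof.
move=> /andP[p0 p1].
rewrite /nu -addn1 PoszD lerD2r floor_ge_int ler_ndivlMr; last first.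
  by rewrite ln_lt0; lra.
rewrite -[RHS]ler_ln ?posrE ?exprn_gt0 //; last by lra.
by rewrite lnXn ?mulr_natl //; lra.
Qed.

(** * The two optimal strategies *)

Theorem proposition1 (R : realType) (p : R) (n : nat) (n_gt0 : (0 < n)%N) :
  (2^-1 <= p <= 1 ->
     optimal p n (follow_strategy n) /\
     (forall (eps : {ffun 'I_n -> bool}) (i : nat), (i < n)%N ->
        end_shown n (take i (deck eps)) ->
        follow_strategy n (take i (deck eps)) = nth 0%N (deck eps) i)) /\
  (0 < p < 2^-1 ->
     ((2 <= n)%N -> maxP p n = (if n%:Z <= nu p then n else 1%N)) /\
     optimal p n (greedy_strategy p n)).
Proof.
case: n n_gt0 => // n _; split=> [p_half|/andP[p0 p2]].
  have p01 : 0 <= p <= 1 by lra.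
  split; last first.
    by move=> eps i lti shown; rewrite /follow_strategy shown endgame.
  apply: optimal_next_prob => // h; first by rewrite /follow_strategy => ->.
  move=> j hidden jn; have -> : follow_strategy n.+1 h = j.+1.
    by rewrite /follow_strategy (negPf hidden) /j; case: (h).
  exact: follow_label_best.
have p01 : 0 <= p <= 1 by lra.
have p01' : 0 < p < 1 by lra.
split=> [_|]; first by rewrite maxPE // nu_ge // /greedy_label subn0.
apply: optimal_next_prob => // h; first by rewrite /greedy_strategy => ->.
(* The first guess is the greedy one at [j = 0], by [maxPE]. *)
move=> j hidden jn; have -> : greedy_strategy p n.+1 h = greedy_label p n j.
  rewrite /greedy_strategy (negPf hidden) /j; case: (h) => [|x s].
    exact: maxPE.
  by rewrite /greedy_label subnAC subn1.
have [] := greedy_label_best p01 jn.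
by split=> // c _.
Qed.
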